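(* Let $K$ be a field, let $n,p,r$ be positive integers with $p\geq 4$, and let $T=\sum_{i=1}^r u_i\otimes v_i\otimes w_i\in K^{n\times n\times p}$ with $u_i,v_i\in K^n$, $w_i\in K^p$. Assume: 1. The vectors $w_1,\ldots,w_r$ are pairwise linearly independent. 2. The first slice $T_1$ of $T$ is invertible. 3. Setting $A_i=T_1^{-1}T_i$ for $i=2,\ldots,p$, the following hold for any three distinct indices $k,l,m\in\{2,\ldots,p\}$: (i) the three linear spaces $\mathrm{Im}[A_k,A_l]$, $\mathrm{Im}[A_k,A_m]$, $\mathrm{Im}[A_l,A_m]$ each have dimension $2(r-n)$; (ii) the three linear spaces $\mathrm{Im}[A_k,A_l]+\mathrm{Im}[A_k,A_m]$, $\mathrm{Im}[A_l,A_k]+\mathrm{Im}[A_l,A_m]$, $\mathrm{Im}[A_m,A_k]+\mathrm{Im}[A_m,A_l]$ each have dimension $3(r-n)$. Then $\mathrm{rank}(T)=r$, and the decomposition of $T$ as a sum of $r$ rank-one tensors is essentially unique.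
   Context: For $u\in K^m,v\in K^n,w\in K^p$, $u\otimes v\otimes w$ is the tensor with entries $u_iv_jw_k$; it has rank one if $u,v,w\neq 0$. The rank of a tensor is the least number of rank-one tensors summing to it. For $T\in K^{m\times n\times p}$ with entries $T_{ijk}$, the slices are the matrices $T_k=(T_{ijk})_{i,j}\in M_{m,n}(K)$, $k=1,\ldots,p$. A decomposition as a sum of $r$ rank-one tensors is essentially unique if any two such decompositions coincide up to permutation of the rank-one terms. $[A,B]=AB-BA$ and $\mathrm{Im}\,A$ is the column space of $A$. *)

(* Defs.v *)
From mathcomp Require Import all_boot all_order all_algebra all_fingroup.
Set Implicit Arguments.
Unset Strict Implicit.
Unset Printing Implicit Defensive.
Import GRing.Theory.
Local Open Scope ring_scope.

Notation tensor K m n p := {ffun 'I_m * 'I_n * 'I_p -> K}.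

Section Tensors.

Variables (K : fieldType) (m n p : nat).
Implicit Types (T t : tensor K m n p) (r : nat).

Definition tensor_prod (u : 'cV[K]_m) (v : 'cV[K]_n) (w : 'cV[K]_p) :
    tensor K m n p :=
  [ffun x => u x.1.1 0 * v x.1.2 0 * w x.2 0].

Definition rank_one t : Prop :=
  exists u v w, [/\ u != 0, v != 0, w != 0 & t = tensor_prod u v w].

Definition rank_one_decomposition T r (t : 'I_r -> tensor K m n p) : Prop :=
  (forall i, rank_one (t i)) /\ T = \sum_(i < r) t i.

(* The rank is a least element, hence a relation: over an arbitrary field it is
   not computable, and the relation determines r. *)
Definition has_tensor_rank T r : Prop :=
  (exists t : 'I_r -> tensor K m n p, rank_one_decomposition T t) /\
  (forall s (t : 'I_s -> tensor K m n p),
     rank_one_decomposition T t -> (r <= s)%N).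

Definition essentially_unique_decomposition T r : Prop :=
  forall t1 t2 : 'I_r -> tensor K m n p,
    rank_one_decomposition T t1 -> rank_one_decomposition T t2 ->
    exists s : {perm 'I_r}, forall i, t2 i = t1 (s i).

Definition slice T (k : 'I_p) : 'M[K]_(m, n) := \matrix_(i, j) T (i, j, k).

Definition commutator_mx (A B : 'M[K]_n) : 'M[K]_n := A *m B - B *m A.

Definition column_space (A : 'M[K]_(m, n)) : {vspace 'cV[K]_m} :=
  <<[seq col j A | j <- enum 'I_n]>>%VS.

End Tensors.

(* Main.v *)
(** Replacing the first slice by [sum_k t^k T_k] over the field of rational
    functions [K(t)], one may assume that the pairing of every [w_i] with the
    weights [t^k] is nonzero; the ranks of the commutators cannot drop, since
    [t = 0] gives back the original slices.  A decomposition of length [r] then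
    exhibits the matrices [A_k] as corner blocks of commuting diagonalizable
    matrices [Z_k = (A_k, B_k; C_k, D_k)] of size [r], and
    [[A_k, A_l] = B_l C_k - B_k C_l] has rank at most [2 (r - n)]: this bounds
    the rank of the tensor from below.  For uniqueness, the rank hypotheses
    identify the row space of [C_k] as the intersection of those of
    [[A_k, A_l]] and [[A_k, A_m]].  Hence two extensions [Z] and [Z'] are
    conjugate by a matrix fixing the corner block; it intertwines two families
    of diagonal matrices, the first with distinct joint eigenvalues, so it is
    monomial and permutes the rank-one terms. *)

Require Import Defs.
From HB Require Import structures.
From mathcomp Require Import all_boot all_order all_algebra all_fingroup.
From mathcomp Require Import fraction ring.
Set Implicit Arguments.
Unset Strict Implicit.
Unset Printing Implicit Defensive.
Import GRing.Theory.
Local Open Scope ring_scope.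

(** * Commuting extensions *)

(** Subtracting [h] times the first relation from the second leaves a relation between the rows of
    [C] and [C1] with coefficients [D1' *m h - h *m D1] and [h *m D - D' *m h]; independence of
    these rows kills both. *)
Lemma lower_right_conj (F : fieldType) q n (h D D1 D' D1' : 'M[F]_q)
    (C C1 : 'M[F]_(q, n)) (A A1 : 'M[F]_n) :
  row_free (col_mx C C1) ->
  C *m A1 + D *m C1 = C1 *m A + D1 *m C ->
  (h *m C) *m A1 + D' *m (h *m C1) = (h *m C1) *m A + D1' *m (h *m C) ->
  D' *m h = h *m D.
Proof.
move=> CC /(congr1 (mulmx h)) e e'.
have : row_mx (D1' *m h - h *m D1) (h *m D - D' *m h) *m col_mx C C1
    = 0 *m col_mx C C1.
  rewrite mul_row_col mul0mx !mulmxBl; move: e e'; rewrite !mulmxDr !mulmxA.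
  move=> /(canRL (addKr _)) -> /(canRL (addKr _)) ->.
  by rewrite !(addrA (- _)) [- _ + _ + h *m D1 *m C]addrC addrKA addrA subrK subrr.
by move=> e0; have := row_free_inj CC e0; rewrite -row_mx0 => /eq_row_mx[_ /eqP];
  rewrite subr_eq0 => /eqP ->.
Qed.

Section CommutingExtensions.

Variables (F : fieldType) (n : nat) (I : eqType) (A : I -> 'M[F]_n).

(* In the basis given by the columns of [Y] and [N], the matrix [Z k] of size
   [r] has [A k] as its upper left block. *)
Record commuting_extension r q (X : 'M[F]_(n, r)) (N : 'M[F]_(r, q))
    (Y : 'M[F]_(r, n)) (M : 'M[F]_(q, r)) (Z : I -> 'M[F]_r) : Prop :=
  CommutingExtension {
    ext_XY : X *m Y = 1%:M;
    ext_XN : X *m N = 0;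
    ext_MY : M *m Y = 0;
    ext_MN : M *m N = 1%:M;
    ext_YX : Y *m X + N *m M = 1%:M;
    ext_comm : forall k l, Z k *m Z l = Z l *m Z k;
    ext_block : forall k, A k = X *m Z k *m Y }.

(** The rows of [M] form a basis of the left kernel of [Y]. Since [1 - Y *m X] also annihilates [Y],
    it factors as [N *m M]; cancelling [M] on the right gives the relations for [N]. *)
Lemma commuting_extension_exists r q (X : 'M[F]_(n, r)) (Y : 'M[F]_(r, n))
    (Z : I -> 'M[F]_r) :
  q = (r - n)%N -> X *m Y = 1%:M ->
  (forall k l, Z k *m Z l = Z l *m Z k) ->
  (forall k, A k = X *m Z k *m Y) ->
  exists (N : 'M[F]_(r, q)) (M : 'M[F]_(q, r)), commuting_extension X N Y M Z.
Proof.
move=> q_def XY ZC AE.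
have [M freeM kerM] : exists2 M : 'M[F]_(q, r), row_free M & (M :=: kermx Y)%MS.
  have rkY : \rank Y = n.
    apply/eqP; rewrite eqn_leq rank_leq_col /=.
    by rewrite -[X in (X <= _)%N](mxrank1 F) -XY mxrankM_maxr.
  have -> : q = \rank (kermx Y) by rewrite mxrank_ker rkY.
  by exists (row_base (kermx Y)); [apply: row_base_free | apply: eq_row_base].
have MY : M *m Y = 0 by apply/sub_kermxP; rewrite kerM.
have /submxP [N NM] : (1%:M - Y *m X <= M)%MS.
  rewrite kerM; apply/sub_kermxP.
  by rewrite mulmxBl mul1mx -mulmxA XY mulmx1 subrr.
exists N, M; split=> //; last by rewrite -NM addrC subrK.
- apply: (row_free_inj freeM).
  by rewrite -mulmxA -NM mulmxBr mulmxA XY mulmx1 mul1mx subrr mul0mx.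
- apply: (row_free_inj freeM).
  by rewrite -mulmxA -NM mulmxBr mulmxA MY mul0mx subr0 mulmx1 mul1mx.
Qed.

Lemma ext_size_ge r q X N Y M Z :
  @commuting_extension r q X N Y M Z -> (n <= r)%N.
Proof.
move=> E; rewrite -[X in (X <= _)%N](mxrank1 F) -(ext_XY E).
exact: leq_trans (mxrankM_maxl _ _) (rank_leq_col _).
Qed.

(** Inserting [Y *m X + N *m M = 1] between [Z i] and [Z j] writes [A i *m A j] as a term symmetric
    in [i], [j] minus an upper right block times a lower left block. *)
Lemma ext_commutator r q X N Y M Z :
  @commuting_extension r q X N Y M Z -> forall k l,
  commutator_mx (A k) (A l) =
    row_mx (X *m Z l *m N) (- (X *m Z k *m N)) *m
      col_mx (M *m Z k *m Y) (M *m Z l *m Y).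
Proof.
move=> E k l; rewrite mul_row_col mulNmx /commutator_mx.
have mid i j : A i *m A j =
    X *m (Z i *m Z j) *m Y - (X *m Z i *m N) *m (M *m Z j *m Y).
  rewrite !(ext_block E) -[Z i in X in X - _]mulmx1 -(ext_YX E).
  by rewrite !(mulmxDr, mulmxDl) !mulmxA addrK.
by rewrite !mid (ext_comm E k l) opprB addrC addrA subrK.
Qed.

(** Lower left block of [Z k *m Z l = Z l *m Z k] in the adapted basis. *)
Lemma ext_lower_row r q X N Y M Z :
  @commuting_extension r q X N Y M Z -> forall k l,
  (M *m Z k *m Y) *m A l + (M *m Z k *m N) *m (M *m Z l *m Y) =
  (M *m Z l *m Y) *m A k + (M *m Z l *m N) *m (M *m Z k *m Y).
Proof.
move=> E k l.
have mid i j : (M *m Z i *m Y) *m A j + (M *m Z i *m N) *m (M *m Z j *m Y) =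
    M *m (Z i *m Z j) *m Y.
  rewrite (ext_block E) -[Z i in RHS]mulmx1 -(ext_YX E).
  by rewrite !(mulmxDr, mulmxDl) !mulmxA.
by rewrite !mid (ext_comm E).
Qed.

Lemma rank_commutator_le r q X N Y M Z :
  @commuting_extension r q X N Y M Z -> forall k l,
  (\rank (commutator_mx (A k) (A l)) <= 2 * q)%N.
Proof.
move=> E k l; rewrite (ext_commutator E) mul2n -addnn.
exact: leq_trans (mxrankM_maxl _ _) (rank_leq_col _).
Qed.

(** * Uniqueness of the extension under the rank conditions *)

Section Generic.

Variables (q : nat) (P : pred I) (k0 : I).
Hypothesis avoid2 : forall k l, exists m, [&& P m, m != k & m != l].
Hypothesis rank_comm : forall k l m,
  P k -> P l -> P m -> k != l -> k != m -> l != m ->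
  (2 * q <= \rank (commutator_mx (A k) (A l)))%N /\
  (3 * q <= \rank (commutator_mx (A k) (A l) + commutator_mx (A k) (A m))%MS)%N.

Lemma rank_comm2 k l : P k -> P l -> k != l ->
  (2 * q <= \rank (commutator_mx (A k) (A l)))%N.
Proof.
move=> Pk Pl kl; have [m /and3P[Pm mk ml]] := avoid2 k l.
by have [] := rank_comm Pk Pl Pm kl; rewrite // eq_sym.
Qed.

Section Ranks.

Variables (r : nat) (X : 'M[F]_(n, r)) (N : 'M[F]_(r, q)).
Variables (Y : 'M[F]_(r, n)) (M : 'M[F]_(q, r)) (Z : I -> 'M[F]_r).
Hypothesis E : commuting_extension X N Y M Z.

(** [ext_commutator] factors the commutator through dimension [2 * q], so rank [2 * q] forces full
    rank on both factors. *)
Lemma ext_col_free k l : P k -> P l -> k != l ->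
  row_free (col_mx (M *m Z k *m Y) (M *m Z l *m Y)).
Proof.
move=> Pk Pl kl; rewrite /row_free eqn_leq rank_leq_row /=.
have := rank_comm2 Pk Pl kl; rewrite mul2n -addnn => /leq_trans; apply.
by rewrite (ext_commutator E) mxrankM_maxr.
Qed.

Lemma ext_row_full k l : P k -> P l -> k != l ->
  row_full (row_mx (X *m Z l *m N) (- (X *m Z k *m N))).
Proof.
move=> Pk Pl kl; rewrite /row_full eqn_leq rank_leq_col /=.
have := rank_comm2 Pk Pl kl; rewrite mul2n -addnn => /leq_trans; apply.
by rewrite (ext_commutator E) mxrankM_maxl.
Qed.

Lemma ext_row_full1 k : P k -> row_full (X *m Z k *m N).
Proof.
move=> Pk; have [l /and3P[Pl lk _]] := avoid2 k k.
have /row_fullP [B] := ext_row_full Pl Pk lk.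
rewrite -[B]vsubmxK mul_col_row scalar_mx_block => /eq_block_mx [h _ _ _].
by apply/row_fullP; exists (usubmx B).
Qed.

Lemma ext_col_free1 k : P k -> row_free (M *m Z k *m Y).
Proof.
move=> Pk; have [l /and3P[Pl lk _]] := avoid2 k k.
rewrite eq_sym in lk; have /row_freeP [B] := ext_col_free Pk Pl lk.
rewrite -[B]hsubmxK mul_col_row scalar_mx_block => /eq_block_mx [h _ _ _].
by apply/row_freeP; exists (lsubmx B).
Qed.

(* The two commutators have rank [2 * q] and their sum has rank [3 * q], so
   their intersection has rank [q], which is the rank of [M *m Z k *m Y]. *)
Lemma ext_lower_left_eqmx k l m :
  P k -> P l -> P m -> k != l -> k != m -> l != m ->
  (M *m Z k *m Y :=:
    commutator_mx (A k) (A l) :&: commutator_mx (A k) (A m))%MS.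
Proof.
move=> Pk Pl Pm kl km lm; apply/eqmxP.
have sub j : P j -> k != j ->
    (M *m Z k *m Y <= commutator_mx (A k) (A j))%MS.
  move=> Pj kj; have [D D1] := row_fullP (ext_row_full Pk Pj kj).
  have le_col : (M *m Z k *m Y <= col_mx (M *m Z k *m Y) (M *m Z j *m Y))%MS.
    by rewrite -addsmxE addsmxSl.
  apply: submx_trans le_col _.
  by rewrite (ext_commutator E) -{1}[col_mx _ _]mul1mx -D1 -mulmxA submxMl.
have le_cap : (M *m Z k *m Y <=
    commutator_mx (A k) (A l) :&: commutator_mx (A k) (A m))%MS.
  by rewrite sub_capmx !sub.
rewrite -(geq_leqif (mxrank_leqif_eq le_cap)).
rewrite (eqP (ext_col_free1 Pk)).
have [_ h3] := rank_comm Pk Pl Pm kl km lm.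
rewrite -(leq_add2l (3 * q)).
apply: leq_trans (leq_add h3 (leqnn _)) _.
rewrite mxrank_sum_cap -[X in (_ <= _ + X)%N]mul1n -mulnDl (mulnDl 2 2).
by rewrite leq_add // (rank_commutator_le E).
Qed.

End Ranks.

Lemma commuting_extension_unique r X N Y M Z X' N' Y' M' Z' :
  @commuting_extension r q X N Y M Z ->
  @commuting_extension r q X' N' Y' M' Z' ->
  exists G Gi : 'M[F]_r,
    [/\ Gi *m G = 1%:M, X' = X *m G, Y' = Gi *m Y &
        forall k, P k -> Z k *m G = G *m Z' k /\ Gi *m Z k = Z' k *m Gi].
Proof.
move=> E E'.
pose B k := X *m Z k *m N; pose B' k := X' *m Z' k *m N'.
pose C k := M *m Z k *m Y; pose C' k := M' *m Z' k *m Y'.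
pose D k := M *m Z k *m N; pose D' k := M' *m Z' k *m N'.
(* Both row spaces equal one intersection that depends on [A] alone. *)
have subC k : P k -> (C' k <= C k)%MS.
  move=> Pk; have [l /and3P[Pl lk _]] := avoid2 k k.
  have [m /and3P[Pm mk ml]] := avoid2 k l.
  rewrite eq_sym in lk; rewrite eq_sym in mk; rewrite eq_sym in ml.
  by rewrite (ext_lower_left_eqmx E Pk Pl Pm) // (ext_lower_left_eqmx E' Pk Pl Pm).
have [H C'E] : exists H : I -> 'M_q, forall k, P k -> C' k = H k *m C k.
  by exists (fun k => C' k *m pinvmx (C k)) => k Pk; rewrite mulmxKpV ?subC.
(* Two factorizations of the same commutator are compared, and the independent rows of [C k] and
   [C l] are cancelled. *)
have BE k l : P k -> P l -> k != l -> B k = B' k *m H l.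
  move=> Pk Pl kl.
  have := ext_commutator E k l; rewrite (ext_commutator E').
  rewrite -/(B k) -/(B l) -/(B' k) -/(B' l) -/(C' k) -/(C' l) !C'E //.
  rewrite mul_row_col (mulmxA (B' l)) (mulmxA (- B' k)) -mul_row_col => e.
  have /eq_row_mx[_] := row_free_inj (ext_col_free E Pk Pl kl) e.
  by rewrite mulNmx => /oppr_inj ->.
(* A third index [k] gives [B' k *m H l = B k = B' k *m H m], and [B' k] cancels on the left. So a
   single [h] serves all indices in [P]. *)
have HE l m : P l -> P m -> H l = H m.
  move=> Pl Pm; have [k /and3P[Pk kl km]] := avoid2 l m.
  by apply: (row_full_inj (ext_row_full1 E' Pk)); rewrite -!BE.
have [l0 /and3P[Pl0 _ _]] := avoid2 k0 k0.
pose h := H l0.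
have Ch k : P k -> C' k = h *m C k by move=> Pk; rewrite C'E // (HE k l0).
have Bh k : P k -> B k = B' k *m h.
  move=> Pk; have [l /and3P[Pl lk _]] := avoid2 k k.
  by rewrite (BE k l) 1?eq_sym // (HE l l0).
have h_unit : h \in unitmx.
  rewrite -row_free_unit /row_free eqn_leq rank_leq_row /=.
  rewrite -[X in (X <= _)%N](eqP (ext_col_free1 E' Pl0)) -/(C' l0) Ch //.
  exact: mxrankM_maxl.
have DE k l : P k -> P l -> k != l -> D' k *m h = h *m D k.
  move=> Pk Pl kl.
  have := ext_lower_row E' k l; rewrite -/(C' k) -/(C' l) (Ch k) // (Ch l) //.
  exact: (lower_right_conj (ext_col_free E Pk Pl kl) (ext_lower_row E k l)).
(* In the two adapted bases, [G] is block diagonal with blocks [1] and [invmx h]. *)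
pose G := Y *m X' + N *m invmx h *m M'.
pose Gi := Y' *m X + N' *m h *m M.
have XG : X *m G = X'.
  by rewrite mulmxDr !mulmxA (ext_XY E) (ext_XN E) !mul0mx addr0 mul1mx.
have GiY : Gi *m Y = Y'.
  by rewrite mulmxDl -!mulmxA (ext_XY E) (ext_MY E) !mulmx0 addr0 mulmx1.
have GiG : Gi *m G = 1%:M.
  rewrite mulmxDl -!mulmxA XG mulmxDr (mulmxA M Y) (ext_MY E) mul0mx add0r.
  by rewrite -(mulmxA N) (mulmxA M N) (ext_MN E) mul1mx mulKVmx // (ext_YX E').
have GGi : G *m Gi = 1%:M by apply: mulmx1C.
have ZE k : P k -> Gi *m Z k *m G = Z' k.
  move=> Pk; have [l /and3P[Pl lk _]] := avoid2 k k; rewrite eq_sym in lk.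
  transitivity (Y' *m (X *m Z k *m Y) *m X' + N' *m (h *m C k) *m X' +
      (Y' *m B k *m invmx h *m M' + N' *m (h *m D k) *m invmx h *m M')).
    by rewrite /Gi /G /B /C /D !(mulmxDr, mulmxDl) !mulmxA.
  rewrite -(ext_block E) (ext_block E') Bh // -Ch // -(DE k l) // !mulmxA !mulmxK //.
  rewrite -[Z' k in RHS]mul1mx -[_ *m Z' k in RHS]mulmx1 -(ext_YX E').
  by rewrite /C' /D' !(mulmxDr, mulmxDl) !mulmxA.
exists G, Gi; split=> // k Pk; split; first by rewrite -ZE // !mulmxA GGi mul1mx.
by rewrite -ZE // -!mulmxA GGi mulmx1.
Qed.
End Generic.
End CommutingExtensions.

(** [R i j] will express equality of joint eigenvalues. Column [j] of [G] and row [j] of [Gi] are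
    supported on at most one [i], and [Gi *m G = 1] makes this [i] exist and depend injectively on
    [j]. *)
Lemma monomial_of_support (F : fieldType) r (G Gi : 'M[F]_r)
    (R : 'I_r -> 'I_r -> Prop) :
  Gi *m G = 1%:M ->
  (forall i j, G i j != 0 -> R i j) -> (forall i j, Gi j i != 0 -> R i j) ->
  (forall i i' j, R i j -> R i' j -> i = i') ->
  exists2 s : 'I_r -> 'I_r, injective s & forall j,
    [/\ R (s j) j, Gi j (s j) * G (s j) j = 1
      & forall i, i != s j -> G i j = 0 /\ Gi j i = 0].
Proof.
move=> GiG supG supGi R_inj.
have GiGE j j' : \sum_i Gi j i * G i j' = (j == j')%:R.
  by move/matrixP/(_ j j'): GiG; rewrite !mxE.
have /fin_all_exists [s sP] j : exists i, R i j.
  case: (pickP (fun i => Gi j i != 0)) => [i /supGi | Gi0]; first by exists i.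
  have := GiGE j j; rewrite eqxx big1 => [/esym/eqP|i _]; first by rewrite oner_eq0.
  by rewrite (eqP (negbFE (Gi0 i))) mul0r.
have off j i : i != s j -> G i j = 0 /\ Gi j i = 0.
  move=> i_s; split; apply/eqP; apply: contraNT i_s => nz; apply/eqP.
    exact: R_inj (supG _ _ nz) (sP j).
  exact: R_inj (supGi _ _ nz) (sP j).
have sum_s j j' : Gi j (s j) * G (s j) j' = (j == j')%:R.
  rewrite -GiGE (bigD1 (s j)) //= big1 ?addr0 // => i /off[_ ->].
  by rewrite mul0r.
exists s => [j j' s_eq | j]; last first.
  by split; [apply: sP | rewrite sum_s eqxx | apply: off].
apply/eqP; apply: contraT => jj'; have := sum_s j j'; rewrite (negbTE jj') s_eq.
move/eqP; rewrite mulf_eq0 => /orP[] /eqP z.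
  by have := sum_s j j; rewrite s_eq z mul0r eqxx => /esym/eqP; rewrite oner_eq0.
by have := sum_s j' j'; rewrite z mulr0 eqxx => /esym/eqP; rewrite oner_eq0.
Qed.

(** * Matrix pencils with a diagonal factorization *)

Section Pencils.

Variables (F : fieldType) (n p : nat) (S : 'I_p -> 'M[F]_n) (c : 'I_p -> F).

Let Sc := \sum_k c k *: S k.
Let A k := S k *m invmx Sc.

Hypothesis Sc_unit : Sc \in unitmx.

Definition weight r (W : 'M[F]_(p, r)) (i : 'I_r) : F := \sum_k c k * W k i.

(** The diagonal extension of [A k]: its eigenvalues are the [k]-th coordinates of the columns of
    [W], scaled to weight 1. *)
Definition ratio_mx r (W : 'M[F]_(p, r)) (k : 'I_p) : 'M[F]_r :=
  diag_mx (\row_i (W k i / weight W i)).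

Definition pencil_factorization r (V : 'M[F]_(n, r)) (W : 'M[F]_(p, r))
    (U : 'M[F]_(n, r)) : Prop :=
  (forall k, S k = V *m diag_mx (row k W) *m U^T) /\
  (forall i, weight W i != 0).

(** A right inverse of [V], read off from the factorization of [Sc] whose diagonal part consists of
    the weights. *)
Definition dual_factor r (W : 'M[F]_(p, r)) (U : 'M[F]_(n, r)) : 'M[F]_(r, n) :=
  diag_mx (\row_i weight W i) *m U^T *m invmx Sc.

Lemma pencil_commuting_extension r V W U q :
  @pencil_factorization r V W U -> q = (r - n)%N ->
  exists (N : 'M[F]_(r, q)) (M : 'M[F]_(q, r)),
    commuting_extension A V N (dual_factor W U) M (ratio_mx W).
Proof.
move=> [SE w0] q_def; apply: commuting_extension_exists => //.
- rewrite /dual_factor !mulmxA.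
  have -> : V *m diag_mx (\row_i weight W i) *m U^T = Sc.
    rewrite /Sc (eq_bigr (fun k => V *m (c k *: diag_mx (row k W)) *m U^T)).
      rewrite -mulmx_suml -mulmx_sumr; congr (_ *m _ *m _).
      apply/matrixP=> i j; rewrite summxE !mxE /weight -sumrMnl.
      by apply: eq_bigr => k _; rewrite !mxE mulrnAr.
    by move=> k _; rewrite SE -scalemxAr -scalemxAl.
  exact: mulmxV.
- by move=> k l; rewrite /ratio_mx diag_mxC.
- move=> k; rewrite /A SE /dual_factor !mulmxA; congr (_ *m _ *m _).
  rewrite -mulmxA; congr (_ *m _); rewrite mulmx_diag; congr diag_mx.
  by apply/rowP=> i; rewrite !mxE divfK.
Qed.

(** This normalization recovers the ratio at [k0] from the others when [c k0 != 0]. *)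
Lemma sum_ratio_mx r (W : 'M[F]_(p, r)) i :
  weight W i != 0 -> \sum_k c k * (W k i / weight W i) = 1.
Proof.
move=> w0; rewrite -(divff w0) {2}/weight mulr_suml.
by apply: eq_bigr => k _; rewrite mulrA.
Qed.

Section Uniqueness.

Variables (k0 : 'I_p) (r q : nat).
Variables (V : 'M[F]_(n, r)) (W : 'M[F]_(p, r)) (U : 'M[F]_(n, r)).
Hypothesis q_def : q = (r - n)%N.
Hypothesis c0 : c k0 != 0.
Hypothesis p_ge4 : (4 <= p)%N.
Hypothesis rank_comm : forall k l m,
  k != k0 -> l != k0 -> m != k0 -> k != l -> k != m -> l != m ->
  (2 * q <= \rank (commutator_mx (A k) (A l)))%N /\
  (3 * q <= \rank (commutator_mx (A k) (A l) + commutator_mx (A k) (A m))%MS)%N.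

(** Here [4 <= p] enters: three indices cannot exhaust ['I_p]. *)
Lemma ord_avoid3 (k l : 'I_p) : exists m, [&& m != k0, m != k & m != l].
Proof.
have /subsetPn [m _] : ~~ ([set: 'I_p] \subset [set k0; k; l]).
  apply: contraL p_ge4 => /subset_leq_card; rewrite cardsT card_ord -leqNgt.
  by move/leq_trans; apply; rewrite -setUA !cardsU1 cards1; do 2 case: (_ \notin _).
by rewrite !inE !negb_or -andbA; exists m.
Qed.

Lemma factorization_length_ge s V' W' U' :
  @pencil_factorization s V' W' U' -> (n + q <= s)%N.
Proof.
move=> fact.
have [k /and3P[k_k0 _ _]] := ord_avoid3 k0 k0.
have [l /and3P[l_k0 l_k _]] := ord_avoid3 k k.
have [m /and3P[m_k0 m_k m_l]] := ord_avoid3 k l.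
have [N [M E]] := pencil_commuting_extension fact (erefl _).
rewrite -leq_subRL ?(ext_size_ge E) // -(@leq_pmul2l 2) //.
apply: leq_trans (rank_commutator_le E k l).
by have [] := rank_comm k_k0 l_k0 m_k0; rewrite // eq_sym.
Qed.

Hypothesis W_indep : forall i j, i != j ->
  exists k l, W k i * W l j != W l i * W k j.

Lemma factorization_unique V' W' U' :
  pencil_factorization V W U -> @pencil_factorization r V' W' U' ->
  exists2 s : 'I_r -> 'I_r, injective s & forall j a b k,
    U' a j * V' b j * W' k j = U a (s j) * V b (s j) * W k (s j).
Proof.
move=> fact fact'; have [_ w0] := fact; have [_ w0'] := fact'.
have [N [M E]] := pencil_commuting_extension fact q_def.
have [N' [M' E']] := pencil_commuting_extension fact' q_def.
have [G [Gi [GiG V'E Y'E ZE]]] :=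
  @commuting_extension_unique _ _ _ _ _ (fun k => k != k0) k0 ord_avoid3
    rank_comm _ _ _ _ _ _ _ _ _ _ _ E E'.
pose R i j := forall k, W k i / weight W i = W' k j / weight W' j.
have RP i j : (forall k, k != k0 -> W k i / weight W i = W' k j / weight W' j) ->
    R i j.
  move=> eq_ij k; have [-> | /eq_ij //] := eqVneq k k0.
  have := sum_ratio_mx (w0 i); rewrite -(sum_ratio_mx (w0' j)).
  rewrite (bigD1 k0) //= [RHS](bigD1 k0) //=.
  rewrite (eq_bigr (fun l => c l * (W' l j / weight W' j))) => [|l /eq_ij -> //].
  by move/addIr/(mulfI c0).
have supG i j : G i j != 0 -> R i j.
  move=> Gij; apply: RP => k /ZE [ZG _]; apply: (mulIf Gij).
  move/matrixP/(_ i j): ZG; rewrite /ratio_mx mul_diag_mx mul_mx_diag !mxE => ->.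
  by rewrite mulrC.
have supGi i j : Gi j i != 0 -> R i j.
  move=> Gij; apply: RP => k /ZE [_ GZ]; apply: (mulIf Gij).
  move/matrixP/(_ j i): GZ; rewrite /ratio_mx mul_diag_mx mul_mx_diag !mxE => <-.
  by rewrite mulrC.
(* Columns of [W] with equal ratios are proportional, so all their minors vanish. *)
have R_inj i i' j : R i j -> R i' j -> i = i'.
  move=> Rij Rij'; apply/eqP; apply: contraT => /W_indep [k [l /eqP[]]].
  have WE m : W m i = W m i' / weight W i' * weight W i.
    by rewrite Rij' -Rij divfK.
  by rewrite !WE; ring.
have [s s_inj sP] := monomial_of_support GiG supG supGi R_inj.
exists s => // j a b k; have [Rj gg off] := sP j.
have Y'U : diag_mx (\row_i weight W' i) *m U'^T =
    Gi *m (diag_mx (\row_i weight W i) *m U^T).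
  have := Y'E; rewrite /dual_factor [RHS]mulmxA => e.
  by apply: (can_inj (mulmxK (_ : invmx Sc \in unitmx))); rewrite ?unitmx_inv.
have vE : V' b j = V b (s j) * G (s j) j.
  rewrite V'E mxE (bigD1 (s j)) //= big1 ?addr0 // => i /off[-> _].
  by rewrite mulr0.
have uE : weight W' j * U' a j = Gi j (s j) * (weight W (s j) * U a (s j)).
  move/matrixP/(_ j a): Y'U; rewrite mul_diag_mx !mxE => ->.
  rewrite (bigD1 (s j)) //= big1 ?addr0 => [|i /off[_ ->]]; last by rewrite mul0r.
  by rewrite mul_diag_mx !mxE.
have wE : W' k j = W k (s j) / weight W (s j) * weight W' j by rewrite Rj divfK.
transitivity ((weight W' j * U' a j) * V' b j * (W k (s j) / weight W (s j))).
  by rewrite wE; ring.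
(* The scalars that [G] and [Gi] put on [V] and [U] are inverse to each other, and the weights
   cancel. *)
rewrite uE vE -[RHS]mul1r -gg; field; exact: w0.
Qed.

End Uniqueness.

End Pencils.

(** * Base change to rational functions *)

Section Specialization.

Variable K : fieldType.

Local Notation L := {fraction {poly K}}.

Definition frac_const : K -> L := @tofrac {poly K} \o polyC.
HB.instance Definition _ :=
  GRing.RMorphism.copy frac_const (@tofrac {poly K} \o polyC).

(** A compression of the specialized matrix to the identity of size its rank lifts through constant
    matrices. The lifted determinant takes the value 1 at [x], so it is a nonzero polynomial. *)
Lemma rank_specialization m n (M : 'M[{poly K}]_(m, n)) x :
  (\rank (map_mx (horner_eval x) M) <= \rank (map_mx (@tofrac _) M))%N.
Proof.
set A := map_mx _ M.
have /row_freeP [B BE] := row_base_free A.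
have /row_fullP [C CE] : row_full (col_base A) by exact: col_base_full.
have CAB : C *m A *m B = 1%:M.
  transitivity (C *m (col_base A *m row_base A) *m B).
    by rewrite mulmx_base.
  by rewrite mulmxA CE mul1mx BE.
pose M' := map_mx polyC C *m M *m map_mx polyC B.
have M'E : map_mx (horner_eval x) M' = 1%:M.
  rewrite !map_mxM /= -/A -CAB; congr (_ *m _ *m _);
    by apply/matrixP=> i j; rewrite !mxE /= /horner_eval hornerC.
have : map_mx (@tofrac _) M' \in unitmx.
  rewrite unitmxE unitfE det_map_mx /= tofrac_eq0; apply/eqP=> d0.
  have := congr1 (horner_eval x) d0; rewrite -det_map_mx M'E det1 rmorph0.
  by apply/eqP; rewrite oner_eq0.
move/mxrank_unit; rewrite !map_mxM /= => {1}<-.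
exact: leq_trans (mxrankM_maxl _ _) (mxrankM_maxr _ _).
Qed.

End Specialization.

(* A multiple of the commutator of [A *m invmx Q] and [B *m invmx Q] that is
   polynomial in the entries, so that it can be specialized. *)
Definition adj_commutator (R : comNzRingType) n (Q A B : 'M[R]_n) : 'M[R]_n :=
  A *m \adj Q *m (B *m \adj Q) - B *m \adj Q *m (A *m \adj Q).

Lemma map_adj_commutator (R R' : comNzRingType) (f : {rmorphism R -> R'}) n
    (Q A B : 'M[R]_n) :
  map_mx f (adj_commutator Q A B) =
    adj_commutator (map_mx f Q) (map_mx f A) (map_mx f B).
Proof. by rewrite /adj_commutator map_mxB !map_mxM !map_mx_adj. Qed.

Lemma adj_commutatorE (F : fieldType) n (Q A B : 'M[F]_n) : Q \in unitmx ->
  adj_commutator Q A B =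
    (\det Q) ^+ 2 *: commutator_mx (A *m invmx Q) (B *m invmx Q).
Proof.
move=> Q_unit; have adjE : \adj Q = \det Q *: invmx Q.
  by rewrite /invmx Q_unit scalerA divff ?scale1r // -unitfE -unitmxE.
by rewrite /adj_commutator adjE -!scalemxAr -!scalemxAl !scalerA -scalerBr.
Qed.

Section Pencil.

Variables (K : fieldType) (n p : nat) (S : 'I_p -> 'M[K]_n).

Local Notation L := {fraction {poly K}}.
Local Notation f := (@frac_const K).

Definition frac_slice (k : 'I_p) : 'M[L]_n := map_mx f (S k).

(** Distinct powers of the variable give every nonzero constant vector a nonzero weight, whatever
    the size of [K]. *)
Definition frac_coef (k : 'I_p) : L := tofrac ('X^k : {poly K}).

Let Sc : 'M[L]_n := \sum_k frac_coef k *: frac_slice k.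
Let ScX : 'M[{poly K}]_n := \sum_(k < p) 'X^k *: map_mx polyC (S k).

Variable k0 : 'I_p.
Hypothesis k0_eq0 : k0 = 0%N :> nat.
Hypothesis S0_unit : S k0 \in unitmx.

Lemma map_tofrac_ScX : map_mx (@tofrac _) ScX = Sc.
Proof.
rewrite /ScX /Sc raddf_sum; apply: eq_bigr => k _.
by apply/matrixP=> i j; rewrite !mxE /= tofracM.
Qed.

Lemma map_eval_ScX : map_mx (horner_eval 0) ScX = S k0.
Proof.
rewrite /ScX raddf_sum (bigD1 k0) //= big1 => [|k k_k0].
  by rewrite addr0 k0_eq0; apply/matrixP=> i j; rewrite !mxE /horner_eval !hornerE.
apply/matrixP=> i j; rewrite !mxE /horner_eval hornerM hornerXn expr0n.
by rewrite -k0_eq0 (negbTE k_k0 : (k == k0 :> nat) = false) mul0r.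
Qed.

Lemma frac_pencil_unit : Sc \in unitmx.
Proof.
rewrite -map_tofrac_ScX unitmxE unitfE det_map_mx /= tofrac_eq0.
apply/eqP=> d0; have := congr1 (horner_eval 0) d0.
rewrite -det_map_mx map_eval_ScX rmorph0 => /eqP.
by apply/negP; rewrite -unitfE -unitmxE.
Qed.

Let a k := S k *m invmx (S k0).
Let A k := frac_slice k *m invmx Sc.
(** Evaluation at 0 and the embedding in [L] send this polynomial matrix to nonzero multiples of the
    two commutators to be compared. *)
Let MX k l := adj_commutator ScX (map_mx polyC (S k)) (map_mx polyC (S l)).

Lemma eval_MX k l : map_mx (horner_eval 0) (MX k l) =
  (\det (S k0)) ^+ 2 *: commutator_mx (a k) (a l).
Proof.
rewrite map_adj_commutator /= map_eval_ScX -adj_commutatorE //.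
by congr adj_commutator; apply/matrixP=> i j; rewrite !mxE /= /horner_eval hornerC.
Qed.

Lemma tofrac_MX k l : map_mx (@tofrac _) (MX k l) =
  (\det Sc) ^+ 2 *: commutator_mx (A k) (A l).
Proof.
have fS i : map_mx (@tofrac _) (map_mx polyC (S i)) = frac_slice i.
  by rewrite -map_mx_comp.
rewrite map_adj_commutator map_tofrac_ScX !fS.
exact: adj_commutatorE frac_pencil_unit.
Qed.

Lemma rank_commutator_frac k l :
  (\rank (commutator_mx (a k) (a l)) <= \rank (commutator_mx (A k) (A l)))%N.
Proof.
have := rank_specialization (MX k l) 0; rewrite eval_MX tofrac_MX.
by rewrite !mxrank_scale_nz // expf_neq0 // -unitfE -unitmxE ?frac_pencil_unit.
Qed.

Lemma rank_commutator2_frac k l m :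
  (\rank (commutator_mx (a k) (a l) + commutator_mx (a k) (a m))%MS <=
   \rank (commutator_mx (A k) (A l) + commutator_mx (A k) (A m))%MS)%N.
Proof.
have := rank_specialization (col_mx (MX k l) (MX k m)) 0.
rewrite !map_col_mx !eval_MX !tofrac_MX -!scale_col_mx.
rewrite !addsmxE.
by rewrite !mxrank_scale_nz // expf_neq0 // -unitfE -unitmxE ?frac_pencil_unit.
Qed.

End Pencil.

(** * Dimensions of column spaces and matrix ranks *)

Section ColumnSpace.

Variables (K : fieldType) (n : nat).

Lemma column_space_mulmx m m' (C : 'M[K]_(n, m)) (R : 'M[K]_(m, m')) :
  (column_space (C *m R) <= column_space C)%VS.
Proof.
apply/span_subvP=> _ /mapP[j _ ->].
have -> : col j (C *m R) = \sum_i R i j *: col i C.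
  by apply/colP=> i; rewrite !mxE summxE; apply: eq_bigr => k _; rewrite !mxE mulrC.
apply: rpred_sum => i _; apply/rpredZ/memv_span/map_f; exact: mem_enum.
Qed.

(** Both column spaces lie in that of [col_base D], which has only [\rank D] columns. *)
Lemma dim_column_space_add m1 m2 (A : 'M[K]_(n, m1)) (B : 'M[K]_(n, m2)) :
  (\dim (column_space A + column_space B) <= \rank (A^T + B^T)%MS)%N.
Proof.
rewrite addsmxE -tr_row_mx mxrank_tr; set D := row_mx A B.
have sub m (E : 'M[K]_(n, m)) R : E = D *m R ->
    (column_space E <= column_space (col_base D))%VS.
  by move=> ->; rewrite -{1}(mulmx_base D) -mulmxA column_space_mulmx.
apply: (@leq_trans (\dim (column_space (col_base D)))).
  apply: dimvS; rewrite subv_add (sub _ A (col_mx 1%:M 0)) ?(sub _ B (col_mx 0 1%:M)) //.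
    by rewrite mul_row_col mulmx0 mulmx1 add0r.
  by rewrite mul_row_col mulmx0 mulmx1 addr0.
by apply: leq_trans (dim_span _) _; rewrite size_map size_enum_ord.
Qed.

Lemma dim_column_space m (A : 'M[K]_(n, m)) :
  (\dim (column_space A) <= \rank A^T)%N.
Proof.
by have := dim_column_space_add A A; rewrite addvv (addsmx_idPl (submx_refl _)).
Qed.

End ColumnSpace.

(** * Decompositions of tensors *)

Section TensorFactorization.

Variables (K : fieldType) (n p : nat) (T : tensor K n n p).

(* Transposing turns column spaces into the row spaces of [mxalgebra]. *)
Let S (k : 'I_p) : 'M[K]_n := (slice T k)^T.

Definition frac_cols m r (x : 'I_r -> 'cV[K]_m) : 'M[{fraction {poly K}}]_(m, r) :=
  \matrix_(a, i) frac_const (x i a 0).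

Lemma tensor_pencil_factorization r (u v : 'I_r -> 'cV[K]_n)
    (w : 'I_r -> 'cV[K]_p) :
  T = \sum_i tensor_prod (u i) (v i) (w i) -> (forall i, w i != 0) ->
  pencil_factorization (frac_slice S) (@frac_coef K p)
    (frac_cols v) (frac_cols w) (frac_cols u).
Proof.
move=> TE w0; split=> [k | i].
  apply/matrixP=> b a; rewrite !mxE TE sum_ffunE rmorph_sum.
  apply: eq_bigr => i _; rewrite mul_mx_diag !mxE ffunE /= -!rmorphM.
  by rewrite -mulrA mulrC -mulrA mulrCA mulrA [w i k 0 * _]mulrC mulrAC.
have [k wk0] : exists k, w i k 0 != 0.
  by apply/cV0Pn.
(* The weight is the polynomial whose coefficients are the entries of [w i]; exponents stay below
   [p], so the default 0 is never read. *)
have -> : weight (@frac_coef K p) (frac_cols w) i =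
    tofrac (\poly_(k < p) (if insub k is Some k' then w i k' 0 else 0)).
  rewrite /weight poly_def rmorph_sum; apply: eq_bigr => l _ /=.
  by rewrite mxE -tofracM mulrC -mul_polyC (valK l : insub (l : nat) = Some l).
rewrite tofrac_eq0; apply: contraNneq wk0 => /polyP/(_ k).
by rewrite coef_poly ltn_ord coef0 (valK k : insub (k : nat) = Some k) => ->.
Qed.

End TensorFactorization.

(** Nonzero minors express independence in a form that the embedding of [K] in the rational
    functions preserves. *)
Lemma free_pair_minor (K : fieldType) p (x y : 'cV[K]_p) : free [:: x; y] ->
  exists k l, x k 0 * y l 0 != x l 0 * y k 0.
Proof.
move=> xy_free; suff /existsP[k /existsP[l kl]] :
  [exists k, exists l, x k 0 * y l 0 != x l 0 * y k 0] by exists k, l.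
apply: contraLR xy_free; rewrite negb_exists => /forallP minor0.
rewrite free_cons span_seq1 negb_and negbK.
have [-> | /cV0Pn[l yl0]] := eqVneq y 0; first by rewrite seq1_free eqxx orbT.
apply/orP; left; apply/vlineP; exists (x l 0 / y l 0); apply/colP=> k.
have := minor0 k; rewrite negb_exists => /forallP/(_ l); rewrite negbK => /eqP e.
by rewrite mxE mulrAC -e mulfK.
Qed.

Lemma sum_drop_zero (V : nmodType) r (F : 'I_r -> V) i : F i = 0 ->
  exists h : 'I_r.-1 -> 'I_r, \sum_j F j = \sum_j F (h j).
Proof.
case: r F i => [|r] F i Fi0; first by case: i Fi0.
by exists (lift i); rewrite (bigD1_ord i) //= Fi0 add0r.
Qed.

Theorem theorem1p1 (K : fieldType) (n p r : nat)
  (n_gt0 : (0 < n)%N) (p_gt0 : (0 < p)%N) (r_gt0 : (0 < r)%N)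
  (p_ge4 : (4 <= p)%N)
  (T : tensor K n n p)
  (u v : 'I_r -> 'cV[K]_n) (w : 'I_r -> 'cV[K]_p)
  (T_def : T = \sum_(i < r) tensor_prod (u i) (v i) (w i))
  (w_indep : forall i j : 'I_r, i != j -> free [:: w i; w j])
  (T1_inv : slice T (Ordinal p_gt0) \in unitmx)
  (dim_comm :
    let A (i : 'I_p) := invmx (slice T (Ordinal p_gt0)) *m slice T i in
    let Im (i j : 'I_p) := column_space (commutator_mx (A i) (A j)) in
    forall k l m : 'I_p,
      k != Ordinal p_gt0 -> l != Ordinal p_gt0 -> m != Ordinal p_gt0 ->
      k != l -> k != m -> l != m ->
      [/\ \dim (Im k l) = (2 * (r - n))%N,
          \dim (Im k m) = (2 * (r - n))%N
        & \dim (Im l m) = (2 * (r - n))%N] /\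
      [/\ \dim (Im k l + Im k m)%VS = (3 * (r - n))%N,
          \dim (Im l k + Im l m)%VS = (3 * (r - n))%N
        & \dim (Im m k + Im m l)%VS = (3 * (r - n))%N]) :
  has_tensor_rank T r /\ essentially_unique_decomposition T r.
Proof.
pose k0 := Ordinal p_gt0.
have w0 i : w i != 0.
  case: (pickP (fun j => i != j)) => [j /w_indep | all_i].
    by rewrite free_cons span_seq1 => /andP[+ _]; apply: contraNneq => ->; rewrite mem0v.
  (* With [i] as the only index, [w i = 0] would make [T] and its first slice vanish, while
     [n > 0]. *)
  apply: contraL T1_inv => /eqP wi0.
  suff -> : slice T k0 = 0 by rewrite -row_free_unit /row_free mxrank0 eq_sym -lt0n.
  apply/matrixP=> a b; rewrite !mxE T_def sum_ffunE big1 // => j _.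
  by rewrite ffunE -(eqP (negbFE (all_i j))) wi0 mxE mulr0.
pose S k := (slice T k)^T.
have S0_unit : S k0 \in unitmx by rewrite unitmx_tr.
pose Sc := \sum_k frac_coef K k *: frac_slice S k.
have Sc_unit : Sc \in unitmx by apply: frac_pencil_unit S0_unit.
pose A k := frac_slice S k *m invmx Sc.
(* Transposition reverses products, hence changes the sign of commutators. *)
have comm_tr k l : commutator_mx (S k *m invmx (S k0)) (S l *m invmx (S k0)) =
    - (commutator_mx (invmx (slice T k0) *m slice T k)
                     (invmx (slice T k0) *m slice T l))^T.
  by rewrite /commutator_mx [(_ - _)^T]linearB /= opprB !trmx_mul !trmx_inv.
have rank_comm k l m :
  k != k0 -> l != k0 -> m != k0 -> k != l -> k != m -> l != m ->
  (2 * (r - n) <= \rank (commutator_mx (A k) (A l)))%N /\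
  (3 * (r - n) <= \rank (commutator_mx (A k) (A l) + commutator_mx (A k) (A m))%MS)%N.
  move=> k_0 l_0 m_0 kl km lm.
  have [[<- _ _] [<- _ _]] := dim_comm k l m k_0 l_0 m_0 kl km lm; split.
    apply: leq_trans (dim_column_space _) _.
    by rewrite -mxrank_opp -comm_tr rank_commutator_frac.
  apply: leq_trans (dim_column_space_add _ _) _.
  apply: leq_trans (rank_commutator2_frac _ S0_unit k l m) => //.
  by rewrite !comm_tr !addsmxE -opp_col_mx mxrank_opp.
have fact := tensor_pencil_factorization T_def w0.
have le_nr : (n <= r)%N.
  by have [N [M /ext_size_ge]] := pencil_commuting_extension Sc_unit fact (erefl _).
have length_ge s (u' v' : 'I_s -> 'cV[K]_n) (w' : 'I_s -> 'cV[K]_p) :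
    T = \sum_i tensor_prod (u' i) (v' i) (w' i) -> (forall i, w' i != 0) -> (r <= s)%N.
  move=> T_def' w0'; rewrite -(subnKC le_nr).
  exact: (factorization_length_ge Sc_unit p_ge4 rank_comm
            (tensor_pencil_factorization T_def' w0')).
have rank_one_terms s (t : 'I_s -> tensor K n n p) : rank_one_decomposition T t ->
    exists x : 'I_s -> 'cV[K]_n * 'cV[K]_n * 'cV[K]_p,
      [/\ T = \sum_i tensor_prod (x i).1.1 (x i).1.2 (x i).2,
          forall i, (x i).2 != 0
        & forall i, t i = tensor_prod (x i).1.1 (x i).1.2 (x i).2].
  case=> rk1 ->.
  have /fin_all_exists [x xP] i : exists x : 'cV[K]_n * 'cV[K]_n * 'cV[K]_p,
      x.2 != 0 /\ t i = tensor_prod x.1.1 x.1.2 x.2.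
    by have [a [b [c [_ _ c0 ->]]]] := rk1 i; exists (a, b, c).
  exists x; split=> [|i|i]; try by case: (xP i).
  by apply: eq_bigr => i _; case: (xP i).
(* A vanishing term could be dropped, leaving a decomposition of length [r.-1] against
   [length_ge]. *)
have given_neq0 i : tensor_prod (u i) (v i) (w i) != 0.
  apply/eqP=> /(sum_drop_zero (F := fun j => tensor_prod (u j) (v j) (w j))) [h].
  rewrite -T_def => /length_ge/(_ (fun j => w0 (h j))).
  by rewrite -ltnS prednK // ltnn.
split.
  split=> [|s t /rank_one_terms [x [xT x0 _]]]; last exact: length_ge xT x0.
  exists (fun i => tensor_prod (u i) (v i) (w i)); split=> // i.
  exists (u i), (v i), (w i); split=> //; apply: contraNneq (given_neq0 i) => z;
    by apply/eqP/ffunP=> y; rewrite !ffunE z mxE !(mulr0, mul0r).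
(* Pairwise independence is known only for the given [w], so each decomposition is matched with the
   given one and the two permutations are composed. *)
have to_given (t : 'I_r -> tensor K n n p) : rank_one_decomposition T t ->
    exists s : {perm 'I_r}, forall j,
      t j = tensor_prod (u (s j)) (v (s j)) (w (s j)).
  move=> /rank_one_terms [x [xT x0 tE]].
  have indep i j : i != j -> exists k l,
      frac_cols w k i * frac_cols w l j != frac_cols w l i * frac_cols w k j.
    move=> /w_indep /free_pair_minor [k [l kl]]; exists k, l.
    by rewrite !mxE -!rmorphM (inj_eq (fmorph_inj _)).
  have c0 : frac_coef K k0 != 0 by rewrite tofrac_eq0 expr0 oner_eq0.
  have [s s_inj sP] := factorization_unique Sc_unit (erefl _) c0 p_ge4 rank_comm
    indep fact (tensor_pencil_factorization xT x0).
  exists (perm s_inj) => j; rewrite tE permE; apply/ffunP=> -[[a b] k].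
  (* The identity over the rational functions involves constants only and descends to [K] by
     injectivity. *)
  rewrite !ffunE /=; apply: (fmorph_inj (@frac_const K)).
  by have := sP j a b k; rewrite !mxE -!rmorphM.
move=> t1 t2 /to_given [s1 t1E] /to_given [s2 t2E].
by exists (s2 * s1^-1)%g => i; rewrite t1E t2E permM permKV.
Qed.
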